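(* Let $T$ be a weighted tree of order $n$. Then $i_+(T)=i_-(T)=q(T)$, where $q(T)$ is the matching number of $T$.
   Context: A weighted graph is a finite simple graph $G$ together with a weight function assigning a positive real number $w(e)>0$ to each edge $e$. If $V_G=\{v_1,\dots,v_n\}$, its weighted adjacency matrix $A(G)=(a_{ij})$ is the real symmetric $n\times n$ matrix with $a_{ij}=w(v_iv_j)$ if $v_iv_j$ is an edge and $a_{ij}=0$ otherwise. $i_+(G)$ and $i_-(G)$ denote the numbers of positive and negative eigenvalues of $A(G)$, counted with multiplicity. A matching is a set of pairwise vertex-disjoint edges; the matching number $q(G)$ is the maximum cardinality of a matching of $G$. A weighted tree is a weighted graph whose underlying graph is a tree (a single vertex is allowed). *)

(* Defs.v *)
From HB Require Import structures.
From mathcomp Require Import all_boot all_order all_algebra.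
From mathcomp Require Import polyrcf.

Set Implicit Arguments.
Unset Strict Implicit.
Unset Printing Implicit Defensive.

Import Order.TTheory GRing.Theory Num.Theory.

Local Open Scope ring_scope.

(* Edges are two-element sets of vertices.  The values of [weight] outside
   [edges] are never used. *)
Record wgraph (R : rcfType) (V : finType) := WGraph {
  edges : {set {set V}};
  weight : {set V} -> R;
  edges_card2 : forall e, e \in edges -> #|e| = 2%N;
  weight_gt0 : forall e, e \in edges -> 0 < weight e
}.

Section WeightedGraph.

Variables (R : rcfType) (V : finType) (G : wgraph R V).

Definition adj : rel V := [rel u v | [set u; v] \in edges G].

(* The vertices are numbered by [enum_val]. *)
Definition adjmx : 'M[R]_#|V| :=
  \matrix_(i, j) if adj (enum_val i) (enum_val j)
                 then weight G [set enum_val i; enum_val j] else 0.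

Definition is_connected : Prop := (0 < #|V|)%N /\ forall u v, connect adj u v.

(* [ucycle] also accepts the empty cycle and the two-vertex closed walk
   along a single edge, so a graph cycle is a [ucycle] of size at least 3. *)
Definition is_acyclic : Prop :=
  forall c : seq V, ucycle adj c -> (size c < 3)%N.

Definition is_tree : Prop := is_connected /\ is_acyclic.

(* [trivIset] is pairwise disjointness of distinct members. *)
Definition is_matching (M : {set {set V}}) : bool :=
  (M \subset edges G) && trivIset M.

Definition matching_number : nat :=
  \max_(M : {set {set V}} | is_matching M) #|M|.

End WeightedGraph.

(* The list of eigenvalues in R, each repeated according to its multiplicity
   as a root of the characteristic polynomial. *)
Definition eigenvalues (R : rcfType) (n : nat) (A : 'M[R]_n) : seq R :=
  flatten [seq nseq (mup x (char_poly A)) x | x <- rootsR (char_poly A)].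

Definition i_plus (R : rcfType) (V : finType) (G : wgraph R V) : nat :=
  count (fun x => 0 < x) (eigenvalues (adjmx G)).

Definition i_minus (R : rcfType) (V : finType) (G : wgraph R V) : nat :=
  count (fun x => x < 0) (eigenvalues (adjmx G)).

(* Main.v *)
Require Import Defs.
From mathcomp Require Import all_boot all_order all_algebra.
From mathcomp Require Import sesquilinear spectral polyrcf complex.

Set Implicit Arguments.
Unset Strict Implicit.
Unset Printing Implicit Defensive.

Import Order.TTheory GRing.Theory Num.Theory.
Local Open Scope ring_scope.

(** The adjacency matrix [A] of a tree is real symmetric, hence diagonalizable
over [R], so its eigenvalues with multiplicity are the entries of a diagonal
form and [\rank A] counts the nonzero ones, i.e. [i_plus + i_minus].

A tree is bipartite, like any forest; conjugating [A] by the diagonal matrix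
of signs of a 2-colouring gives [- A], so the spectrum is symmetric about [0]
and [i_plus = i_minus] ([bipartite_inertia]).

It remains to see that [\rank A] is twice the matching number
([forest_rank]).  Removing an isolated vertex changes neither.  Removing a
leaf [v] together with its neighbour [u] lowers the rank by exactly two
([rank_pendant]), and the matching number by exactly one, because a matching
has at most one edge at [u], and the only edge at [v] is the one to [u].
This leaves a smaller forest, so the induction runs over vertex subsets [S];
the adjacency matrix is kept at full size and zeroed outside [S], which does
not affect the rank. *)

(** * Spectra of real symmetric matrices *)

(** The spectral theorem over a real closed field, descended from the one for
Hermitian matrices over [R[i]]: real matrices that are similar over [R[i]]
are similar through a real matrix. *)
Lemma symmetric_diagonalizable (R : rcfType) n (A : 'M[R]_n) : A^T = A ->
  exists2 P, P \in unitmx & exists d : 'rV_n, P *m A = diag_mx d *m P.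
Proof.
move=> Asym; pose f := real_complex R; pose B := map_mx f A.
have fR x : f x \is Num.real.
  by apply/complex_realP; exists x.
have Breal : B \is a mxOver Num.real by apply/mxOverP => i j; rewrite mxE.
have Bsym : B \is symmetricmx.
  by apply/is_hermitianmxP; rewrite expr0 scale1r map_mx_id // map_trmx Asym.
have Bherm := realsym_hermsym Bsym Breal.
have := orthomx_spectralP (symmetric_normalmx Bsym Breal).
set P := spectralmx B; set d := spectral_diag B => Bd.
have dreal : d \is a mxOver Num.real by apply: hermitian_spectral_diag_real.
have Pu : P \in unitmx by apply: spectral_unit.
have [|||Q] := @real_similar _ _ B (diag_mx d).
- by exists P => //; apply/simmxP => //; rewrite {1}Bd !mulmxA mulmxV // mul1mx.
- by [].
- apply/mxOverP => i j; rewrite mxE.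
  case: (i == j); rewrite ?mulr1n ?mulr0n ?rpred0 //.
  exact: (mxOverP dreal).
(* The diagonal form and the real change of basis both come from R. *)
have real_mx m k (X : 'M[R[i]%C]_(m, k)) : X \is a mxOver Num.real ->
    X = map_mx f (map_mx (@complex.Re R) X).
  move=> Xr; apply/matrixP => i j; rewrite !mxE.
  exact/esym/RRe_real/(mxOverP Xr).
rewrite inE => /andP[/= /real_mx QE Qu] /(simmxP Qu).
move: Qu; rewrite {}QE (real_mx _ _ _ dreal).
rewrite -map_diag_mx -!map_mxM map_unitmx => Qu.
move=> /map_mx_inj eqQ.
by exists (map_mx (@complex.Re R) Q) => //; exists (map_mx (@complex.Re R) d).
Qed.

Lemma char_poly_similar (F : fieldType) n (P A B : 'M[F]_n) :
  P \in unitmx -> P *m A = B *m P -> char_poly A = char_poly B.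
Proof.
move=> Pu PA; have detP0 : \det (map_mx polyC P) != 0.
  by rewrite det_map_mx polyC_eq0 -unitfE -unitmxE.
apply: (mulfI detP0); rewrite [RHS]mulrC -!det_mulmx /char_poly_mx.
by rewrite mulmxBr mulmxBl -!map_mxM PA scalar_mxC.
Qed.

Lemma char_poly_diag (F : fieldType) n (d : 'rV[F]_n) :
  char_poly (diag_mx d) = \prod_(i < n) ('X - (d 0 i)%:P).
Proof.
rewrite char_poly_trig ?diag_mx_is_trig //.
by apply: eq_bigr => i _; rewrite mxE eqxx.
Qed.

Lemma rank_diag (F : fieldType) n (d : 'rV[F]_n) :
  \rank (diag_mx d) = (\sum_(i < n) (d 0%R i != 0%R))%N.
Proof.
elim: n d => [|n IH] d; first by rewrite big_ord0 [diag_mx d]flatmx0 mxrank0.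
rewrite -[n.+1]/(1 + n)%N in d *.
rewrite -[d in LHS]hsubmxK diag_mx_row rank_diag_block_mx IH big_ord_recl.
congr addn; last first.
  apply: eq_bigr => i _; rewrite mxE.
  by congr (nat_of_bool (d _ _ != _)); apply: val_inj.
have -> : diag_mx (lsubmx d) = lsubmx d.
  by apply/matrixP => i j; rewrite !ord1 mxE eqxx.
rewrite rank_rV; congr (nat_of_bool (~~ _)).
apply/eqP/eqP => [/rowP/(_ ord0)|d0]; last apply/rowP => i; rewrite !mxE.
  by move=> <-; congr (d _ _); apply: val_inj.
by rewrite ord1 -[RHS]d0; congr (d _ _); apply: val_inj.
Qed.

Lemma perm_eigenvalues (R : rcfType) n (A : 'M[R]_n) s :
  char_poly A = \prod_(x <- s) ('X - x%:P) -> perm_eq (eigenvalues A) s.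
Proof.
rewrite /eigenvalues => chiA.
have rootsP := roots_on_rootsR (monic_neq0 (char_poly_monic A)).
apply/allP => x _ /=; rewrite -[X in _ == X]mu_prod_XsubC -chiA.
rewrite count_flatten sumnE !big_map.
under eq_bigr do rewrite count_nseq /=.
have [xr|xNr] := boolP (x \in rootsR (char_poly A)).
  rewrite (bigD1_seq x) ?uniq_roots //= eqxx mul1n big1 ?addn0 // => y.
  by move=> /negPf->; rewrite mul0n.
rewrite mupNroot; last by move: xNr; rewrite -rootsP.
rewrite big1_seq // => y /= yr; case: eqP => [yx|_]; last by rewrite mul0n.
by rewrite -yx yr in xNr.
Qed.

(** The hypothesis on [c] says that [c] is a proper 2-colouring of the graph of
nonzero entries of [A]. *)
Lemma bipartite_inertia (R : rcfType) n (A : 'M[R]_n) (c : 'I_n -> bool) :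
  A^T = A -> (forall i j, A i j != 0 -> c i != c j) ->
  count (> 0) (eigenvalues A) = count (< 0) (eigenvalues A) /\
  \rank A = (count (< 0) (eigenvalues A)).*2.
Proof.
move=> Asym bip; have [P Pu [d PA]] := symmetric_diagonalizable Asym.
pose s := [seq d 0 i | i <- enum 'I_n].
have chiA : char_poly A = \prod_(x <- s) ('X - x%:P).
  by rewrite (char_poly_similar Pu PA) char_poly_diag big_map big_enum.
have chiNA : char_poly (- A) = \prod_(x <- map -%R s) ('X - x%:P).
  have PNA : P *m - A = diag_mx (- d) *m P by rewrite mulmxN PA raddfN mulNmx.
  rewrite (char_poly_similar Pu PNA) char_poly_diag /s 2!big_map big_enum.
  by apply: eq_bigr => i _; rewrite mxE.
(* S A = - A S, so A and - A have the same characteristic polynomial. *)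
pose S := diag_mx (\row_i (-1) ^+ c i) : 'M[R]_n.
have SS : S *m S = 1%:M.
  apply/matrixP => i j; rewrite mul_diag_mx !mxE.
  by case: eqP => [_|_]; rewrite ?mulr1n ?mulr0n ?mulr0 // -expr2 sqrr_sign.
have SA : S *m A = - A *m S.
  apply/matrixP => i j; rewrite mul_diag_mx mul_mx_diag !mxE.
  have [->|/bip] := eqVneq (A i j) 0; first by rewrite oppr0 mulr0 mul0r.
  by case: (c i); case: (c j) => // _;
    rewrite ?expr0 ?expr1 ?mul1r ?mulr1 ?mulN1r ?mulrN1 ?opprK.
have [Su _] := mulmx1_unit SS.
have sN : perm_eq s (map -%R s).
  by apply: prod_XsubC_eq; rewrite -chiA -chiNA; apply: char_poly_similar Su SA.
have eigs := permP (perm_eigenvalues chiA).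
have posneg : count (> 0) s = count (< 0) s.
  rewrite (permP sN) count_map; apply: eq_count => x /=; exact: oppr_gt0.
rewrite !eigs; split => //.
have -> : \rank A = \rank (diag_mx d).
  rewrite -[in LHS](mulKmx Pu A) PA mulmxA mxrankMfree ?row_free_unit //.
  by rewrite (eqmxMfull _ _) // row_full_unit unitmx_inv.
have countE (a : pred R) : count a s = (\sum_(i < n) a (d 0%R i))%N.
  rewrite -sum1_count big_map big_enum_cond /= big_mkcond.
  by apply: eq_bigr => i _; case: (a _).
rewrite rank_diag -addnn -[X in (X + _)%N]posneg !countE -big_split.
apply: eq_bigr => i _ /=.
by case: (ltgtP (d 0 i) 0).
Qed.

(** * Rank of a matrix with a pendant vertex *)

(** Adding a row that is nonzero in a column where [W] vanishes. *)
Lemma rank_col_mx_row (F : fieldType) m n (r : 'rV[F]_n) (W : 'M_(m, n)) k :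
  r 0 k != 0 -> col k W = 0 -> \rank (col_mx r W) = (\rank W).+1.
Proof.
move=> rk Wk; rewrite -addsmxE mxrank_disjoint_sum.
  by rewrite rank_rV; have [r0|//] := eqVneq r 0; rewrite r0 mxE eqxx in rk.
apply/eqP; rewrite -submx0; apply/rV_subP => x; rewrite sub_capmx.
case/andP => /sub_rVP[a ->] /submxP[z /(congr1 (col k))].
rewrite (colE k (z *m W)) -mulmxA -colE Wk mulmx0.
move=> /colP/(_ ord0); rewrite !mxE => /eqP.
by rewrite mulf_eq0 (negPf rk) orbF => /eqP->; rewrite scale0r sub0mx.
Qed.

(** Row and column [v] of [A] are zero except at their entry in position [u], as
when [v] is a leaf attached to [u]; the matrix on the right is [A] with rows
and columns [u] and [v] zeroed. *)
Lemma rank_pendant (F : fieldType) n (A : 'M[F]_n) (u v : 'I_n) :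
  u != v -> A u v != 0 -> A v u != 0 ->
  (forall i, i != u -> A i v = 0) -> (forall j, j != u -> A v j = 0) ->
  \rank A =
  (\rank (\matrix_(i, j) if (i \in [:: u; v]) || (j \in [:: u; v]) then 0
                         else A i j)).+2.
Proof.
move=> uv Auv Avu colv rowv; set B := \matrix_(i, j) _.
have vu : v != u by rewrite eq_sym.
have BuE : col u B = 0 by apply/colP => i; rewrite !mxE !inE eqxx orbT.
have BvE : col v B = 0 by apply/colP => i; rewrite !mxE !inE eqxx !orbT.
have rvB : \rank (col_mx (row v A) B) = (\rank B).+1.
  by rewrite (@rank_col_mx_row _ _ _ _ _ u) ?mxE.
(* Rows u and v of A and B are independent: column v detects row u, then
   column u detects row v.  Together they span the row space of A. *)
rewrite -rvB.
rewrite -(@rank_col_mx_row _ _ _ (row u A) (col_mx (row v A) B) v) ?mxE //;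
  last first.
  rewrite col_col_mx BvE; apply/colP => i; rewrite mxE.
  by case: split => k; rewrite !mxE ?colv.
apply: eqmx_rank; apply/andP.
have rowB i : i != u -> i != v ->
    row i A = (A i u / A v u) *: row v A + row i B.
  move=> iu iv; apply/rowP => j; rewrite !mxE !inE (negPf iu) (negPf iv) /=.
  have [->|ju] /= := eqVneq j u; first by rewrite divfK // addr0.
  have [->|jv] /= := eqVneq j v; first by rewrite !colv // mulr0 addr0.
  by rewrite (rowv j) // mulr0 add0r.
set X := col_mx _ _.
have uX : (row u A <= X)%MS by rewrite -addsmxE addsmxSl.
have vBX : (col_mx (row v A) B <= X)%MS.
  by rewrite /X -(addsmxE (row u A)) addsmxSr.
have vX : (row v A <= X)%MS.
  by apply: submx_trans vBX; rewrite -addsmxE addsmxSl.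
have BX : (B <= X)%MS by apply: submx_trans vBX; rewrite -addsmxE addsmxSr.
split; first apply/row_subP => i.
  have [->//|iu] := eqVneq i u; have [->//|iv] := eqVneq i v.
  by rewrite rowB // addmx_sub ?scalemx_sub // (submx_trans (row_sub i B)).
rewrite !col_mx_sub !row_sub; apply/row_subP => i.
have [iuv|] := boolP (i \in [:: u; v]).
  rewrite (_ : row i B = 0) ?sub0mx //.
  by apply/rowP => j; rewrite !mxE iuv.
rewrite !inE negb_or => /andP[iu iv].
have -> : row i B = row i A - (A i u / A v u) *: row v A.
  by rewrite (rowB i) // addrC addKr.
by rewrite addmx_sub ?row_sub // -scaleNr scalemx_sub ?row_sub.
Qed.

(** * Forests *)

Section Forest.

Variables (R : rcfType) (V : finType) (G : wgraph R V).

Lemma adj_sym u v : adj G u v = adj G v u.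
Proof. by rewrite /adj /= setUC. Qed.

Lemma adj_irr u : adj G u u = false.
Proof. by apply/negP => /edges_card2; rewrite setUid cards1. Qed.

Lemma edge_at e v : e \in edges G -> v \in e ->
  exists2 w, e = [set v; w] & adj G v w.
Proof.
move=> eG; have /eqP/cards2P[x [y [_ eE]]] := edges_card2 eG.
rewrite eE !inE => /orP[]/eqP->; first by exists y; rewrite // /adj /= -eE.
by exists x; rewrite ?(setUC [set y]) // /adj /= setUC -eE.
Qed.

Hypothesis acyclicG : is_acyclic G.

(** Every nonempty vertex set [S] of a forest has a vertex with at most one
neighbour in [S].  Otherwise every path in [S] could be prolonged at its head
without ever closing a cycle, contradicting finiteness. *)
Lemma acyclic_leaf (S : {set V}) : S != set0 ->
  exists2 v, v \in S & exists u, forall w, w \in S -> adj G v w -> w = u.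
Proof.
case/set0Pn => x0 x0S.
have [/exists_inP[v vS /existsP[u /forall_inP vu]]|] := boolP
    [exists v in S, exists u, [forall w in S, adj G v w ==> (w == u)]].
  by exists v => //; exists u => w wS /(implyP (vu w wS))/eqP.
rewrite negb_exists_in => /forall_inP noleaf.
suff paths k : exists x p, [/\ size p = k, path (adj G) x p,
                               uniq (x :: p) & all (mem S) (x :: p)].
  have [x [p [sp _ /card_uniqP up _]]] := paths #|V|.
  by have := max_card [in x :: p]; rewrite up /= sp ltnn.
elim: k => [|k [x [p [sp xp up Sp]]]]; first by exists x0, [::]; rewrite /= x0S.
have /andP[xS _] := Sp.
(* A neighbour w of x other than the second vertex of the path; on a path
   reduced to x, any neighbour will do. *)
have := noleaf x xS; rewrite negb_exists => /forallP/(_ (head x p)).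
rewrite negb_forall_in => /exists_inP[w wS]; rewrite negb_imply => /andP[xw wh].
exists w, (x :: p); split; rewrite /= ?sp //;
  first by rewrite -/(adj G w x) adj_sym xw.
  apply/andP; split; last exact: up.
  rewrite inE negb_or.
  have wx : w != x by apply: contraTneq xw => ->; rewrite adj_irr.
  rewrite wx /=; case: p wh sp xp up Sp => //= u p wu sp xp up Sp.
  (* If w were on the path, closing the path at w would give a cycle with at
     least the three vertices x, u and w. *)
  rewrite inE negb_or wu /=; apply/negP => /splitPr wp.
  case: wp xp up {sp Sp} => p1 p2.
  rewrite -cat_rcons => /andP[xu]; rewrite cat_path => /andP[up1 _].
  move=> up; have : uniq ((x :: u :: rcons p1 w) ++ p2) by exact: up.
  rewrite cat_uniq => /andP[uniq1 _].
  have := @acyclicG (x :: u :: rcons p1 w).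
  rewrite /ucycle /= size_rcons !ltnS => cyc; have: false; last by [].
  have := cyc _; apply; apply/andP; split; last exact: uniq1.
  by rewrite rcons_path xu up1 last_rcons /= -/(adj G w x) adj_sym.
by apply/andP; split.
Qed.

Lemma acyclic_bipartite (S : {set V}) : exists c : V -> bool,
  forall u v, u \in S -> v \in S -> adj G u v -> c u != c v.
Proof.
have [k] := ubnP #|S|; elim: k S => // k IH S; rewrite ltnS => leSk.
have [->|/acyclic_leaf[v vS [u uP]]] := eqVneq S set0.
  by exists xpredT => u v; rewrite inE.
have [|c cP] := IH (S :\ v); first by rewrite (cardsD1 v S) vS in leSk.
exists (fun w => if w == v then ~~ c u else c w) => x y xS yS xy.
have [xv|xv] := eqVneq x v; have [yv|yv] := eqVneq y v.
- by rewrite xv yv adj_irr in xy.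
- by rewrite -(uP y) // -?xv //; case: (c y).
- by rewrite -(uP x) // -?yv 1?adj_sym //; case: (c x).
- by apply: cP; rewrite ?inE ?xv ?yv.
Qed.

(** The adjacency matrix of the subgraph induced on [S], padded with zeros to
the size of [adjmx G]. *)
Definition adjmx_on (S : {set V}) : 'M[R]_#|V| :=
  \matrix_(i, j) if (enum_val i \in S) && (enum_val j \in S)
                 then adjmx G i j else 0.

Lemma adjmx_sym : (adjmx G)^T = adjmx G.
Proof. by apply/matrixP => i j; rewrite !mxE adj_sym setUC. Qed.

Lemma adjmx_neq0 i j : (adjmx G i j != 0) = adj G (enum_val i) (enum_val j).
Proof.
rewrite mxE; case: ifP => [/weight_gt0/lt0r_neq0->//|_]; by rewrite eqxx.
Qed.

(** [M] is a maximum matching of the subgraph induced on [S]. *)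
Lemma forest_rank (S : {set V}) :
  exists M : {set {set V}},
    [/\ is_matching G M, cover M \subset S, \rank (adjmx_on S) = (#|M|).*2
      & forall M', is_matching G M' -> cover M' \subset S -> (#|M'| <= #|M|)%N].
Proof.
have [k] := ubnP #|S|; elim: k S => // k IH S; rewrite ltnS => leSk.
have [->|/acyclic_leaf[v vS [u uP]]] := eqVneq S set0.
  exists set0; split.
  - by rewrite /is_matching sub0set /trivIset /cover !big_set0 cards0 eqxx.
  - by rewrite /cover big_set0 sub0set.
  - rewrite cards0; apply/eqP; rewrite mxrank_eq0; apply/eqP/matrixP => i j.
    by rewrite !mxE inE.
  move=> M' /andP[/subsetP M'G _]; rewrite subset0 cards0 leqn0 cards_eq0.
  move=> /eqP M'0; apply/set0Pn => -[e eM'].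
  have /edges_card2 := M'G e eM'; have := bigcup_sup e eM' (F := id).
  by rewrite -/(cover M') M'0 subset0 => /eqP->; rewrite cards0.
(* Either v is isolated in S, or u is its unique neighbour in S. *)
have [vu|vNu] := boolP ((u \in S) && adj G v u); last first.
  have isolated w : w \in S -> adj G v w = false.
    move=> wS; apply: contraNF vNu => vw; by rewrite -(uP w wS vw) wS.
  have [|M [Mm MS rM maxM]] := IH (S :\ v).
    by rewrite (cardsD1 v S) vS in leSk.
  exists M; split=> //; first exact: subset_trans MS (subD1set _ _).
    rewrite -rM; congr mxrank; apply/matrixP => i j.
    rewrite [LHS]mxE [RHS]mxE !inE.
    case: ifP => [/andP[iS jS]|]; last first.
      by case: ifP => // /andP[/andP[_ ->]/andP[_ ->]].
    rewrite iS jS !andbT; case: ifP => // /negbT; rewrite negb_and !negbK.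
    move=> ijv.
    apply: contraTeq ijv; rewrite adjmx_neq0 negb_or => ij.
    apply/andP; split; apply: contraTneq ij => vE.
      by rewrite vE isolated.
    by rewrite adj_sym vE isolated.
  move=> M' M'm M'S; apply: maxM => //; rewrite subsetD1 M'S /=.
  apply/bigcupP => -[e eM' ve]; have /andP[/subsetP M'G _] := M'm.
  have [w eE vw] := edge_at (M'G e eM') ve; rewrite isolated // in vw.
  apply: (subsetP M'S); apply/bigcupP; exists e => //.
  by rewrite eE !inE eqxx orbT.
have /andP[uS {}vu] := vu.
have uv : u != v by apply: contraTneq vu => ->; rewrite adj_irr.
pose S' := S :\ u :\ v.
have ltS' : (#|S'| < #|S|)%N.
  apply: proper_card; apply: (sub_proper_trans (subD1set _ _)).
  exact: properD1.
have [|M [/andP[MG Mtriv] MS' rM maxM]] := IH S'.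
  exact: leq_trans ltS' leSk.
have NM x : x \notin S' -> forall e, e \in M -> x \notin e.
  move=> xS' e eM; apply: contra xS' => xe; apply: (subsetP MS').
  by apply/bigcupP; exists e.
have uNM : forall e, e \in M -> u \notin e.
  by apply: NM; rewrite !inE eqxx andbF.
have vNM : forall e, e \in M -> v \notin e by apply: NM; rewrite !inE eqxx.
have uvM : [set v; u] \notin M.
  by apply/negP => /uNM; rewrite !inE eqxx orbT.
have vu_disj e : e \in M -> [disjoint e & [set v; u]].
  move=> eM; rewrite disjoints_subset; apply/subsetP => x xe; rewrite !inE.
  apply: contraTN xe => /orP[]/eqP->; [exact: vNM|exact: uNM].
exists ([set v; u] |: M); split.
- apply/andP; split; first by rewrite subUset sub1set [_ \in _]vu.
  apply/trivIsetP => e f /setU1P[->|eM] /setU1P[->|fM]; rewrite ?eqxx // => ef.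
  + by rewrite disjoint_sym vu_disj.
  + by rewrite vu_disj.
  + exact: (trivIsetP Mtriv).
- rewrite /cover big_setU1 //= !subUset !sub1set vS uS /=.
  exact: (subset_trans MS' (subset_trans (subD1set _ _) (subD1set _ _))).
- rewrite cardsU1 uvM doubleS -rM.
  rewrite (@rank_pendant _ _ _ (enum_rank u) (enum_rank v)).
  + congr (\rank _).+2; apply/matrixP => i j.
    rewrite [LHS]mxE [RHS]mxE !inE [adjmx_on S i j]mxE.
    rewrite -!(inj_eq enum_val_inj) !enum_rankK.
    do 4!case: (_ == _); rewrite //= ?andbF //=.
  + by rewrite (inj_eq enum_rank_inj).
  + by rewrite mxE !enum_rankK uS vS adjmx_neq0 !enum_rankK adj_sym.
  + by rewrite mxE !enum_rankK uS vS adjmx_neq0 !enum_rankK.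
  + move=> i; rewrite mxE enum_rankK vS andbT => iu; case: ifP => // iS.
    apply: contraNeq iu; rewrite adjmx_neq0 enum_rankK adj_sym => /(uP _ iS) <-.
    by rewrite enum_valK.
  move=> j; rewrite mxE enum_rankK vS => ju; case: ifP => // jS.
  apply: contraNeq ju; rewrite adjmx_neq0 enum_rankK => /(uP _ jS) <-.
  by rewrite enum_valK.
move=> M' /andP[/subsetP M'G M'triv] /bigcupsP M'S.
(* Drop from M' its edge at u; if there is none, pblock M' u is empty and not
   an edge, and nothing is dropped.  The rest also avoids v. *)
rewrite cardsU1 uvM (cardsD1 (pblock M' u) M') leq_add ?leq_b1 //; apply: maxM.
  apply/andP; split; first by apply/subsetP => e /setD1P[_ /M'G].
  by apply: trivIsetS M'triv; apply: subD1set.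
apply/bigcupsP => e /setD1P[eu eM'].
have uNe : u \notin e.
  by apply: contra eu => ue; rewrite (def_pblock M'triv eM' ue).
have vNe : v \notin e.
  apply/negP => ve; have [w eE vw] := edge_at (M'G e eM') ve.
  have we : w \in e by rewrite eE !inE eqxx orbT.
  by rewrite -(uP w (subsetP (M'S e eM') w we) vw) we in uNe.
by rewrite !subsetD1 M'S // uNe vNe.
Qed.

End Forest.

Theorem lemma3p1 (R : rcfType) (V : finType) (n : nat) (T : wgraph R V)
    (order_T : #|V| = n) (tree_T : is_tree T) :
  i_plus T = i_minus T /\ i_minus T = matching_number T.
Proof.
have [_ acyclicT] := tree_T.
have [c cP] := acyclic_bipartite acyclicT setT.
have [|posneg rankT] := bipartite_inertia (c := c \o enum_val) (adjmx_sym T).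
  by move=> i j; rewrite adjmx_neq0; apply: cP; rewrite inE.
split=> //; rewrite /i_minus -[LHS]doubleK -rankT.
have [M [Mm _ rankM maxM]] := forest_rank acyclicT setT.
have -> : adjmx T = adjmx_on T setT.
  by apply/matrixP => i j; rewrite [RHS]mxE !inE.
rewrite rankM doubleK; apply/eqP; rewrite eqn_leq; apply/andP; split.
  exact: (leq_bigmax_cond (F := fun M : {set {set V}} => #|M|)).
by apply/bigmax_leqP => M' M'm; apply: maxM => //; apply: subsetT.
Qed.
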